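(* (Composition-Diamond lemma for Gelfand-Dorfman-Novikov algebras) Let $S$ be a non-empty subset of $GDN(X)$ and let $Id(S)$ be the ideal of $GDN(X)$ generated by $S$. Then the following statements are equivalent. (i) $S$ is a Gröbner-Shirshov basis in $GDN(X)$. (ii) If $0\neq h\in Id(S)$, then $\overline{h}=u\,\overline{D^{t}s}$ for some $s\in S$, $u\in[D^{\omega}X]$, $t\in\mathbb{N}$. (iii) The set $Irr(S)=\{w\in[D^{\omega}X]\mid wt(w)=-1,\ w\neq u\,\overline{D^{t}s}\text{ for all }u\in[D^{\omega}X],\ t\in\mathbb{N},\ s\in S\}$ is a linear basis of $GDN(X|S):=GDN(X)/Id(S)$ (that is, the images of its elements form a $k$-basis).
   Context: Let $k$ be a field of characteristic $0$, $X$ a well-ordered set, $\mathbb{N}=\{0,1,2,\dots\}$. $k\{X\}$ is the free commutative differential algebra on $X$: the commutative polynomial algebra over $k$ in the letters $a[i]$ ($a\in X$, $i\ge -1$), with the $k$-linear derivation $D$ given by $D(a[i])=a[i+1]$, $D(1)=0$ (so $a[-1]=a$, $a[i]=D^{i+1}a$). $[D^{\omega}X]$ is the free commutative monoid on these letters; it is a $k$-basis of $k\{X\}$. For $w=a_n[i_n]\cdots a_1[i_1]$ put $|w|=n$ and $wt(w)=i_1+\dots+i_n$; $|1|=wt(1)=0$. Order: $a[i]<b[j]$ iff $(i,a)<(j,b)$ lexicographically. For $w=a_n[i_n]\cdots a_1[i_1]$ with $a_n[i_n]\ge\dots\ge a_1[i_1]$ put $ord(w)=(|w|,a_n[i_n],\dots,a_1[i_1])$,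 and $u<v$ iff $ord(u)<ord(v)$ lexicographically; this is a well order on $[D^\omega X]$. For nonzero $f\in k\{X\}$, $\overline f$ is its leading (largest) word and $LC(f)$ the coefficient of $\overline f$. Conditions involving a leading word $\overline{D^t s}$ only concern $s$ with $D^ts\ne0$. $GDN(X)$ is the span of $\{w\in[D^\omega X]\mid wt(w)=-1\}$ with the product $f\circ g=(Df)g$. It is the free (right-)Gelfand-Dorfman-Novikov algebra on $X$ (with $a\in X$ identified with $a[-1]$), where such algebras are defined by the identities $x\circ(y\circ z)-(x\circ y)\circ z=x\circ(z\circ y)-(x\circ z)\circ y$ and $x\circ(y\circ z)=y\circ(x\circ z)$. Ideals of $GDN(X)$ are two-sided ideals for $\circ$. Compositions in $GDN(X)$: for $u,v\in[D^\omega X]$, a word $w$ is a non-trivial common multiple of $u$ and $v$ in $GDN(X)$ if $wt(w)=-1$, $w$ is a common multiple of $u$ and $v$ in $[D^\omega X]$, and $w\ne uvw'$ for every $w'\in[D^\omega X]$. For $f,g\in GDN(X)$, $t_1,t_2\in\mathbb{N}$ and $w$ a non-trivial common multiple of $\overline{D^{t_1}f}$ and $\overline{D^{t_2}g}$ in $GDN(X)$, write $w=u_1\overline{D^{t_1}f}=u_2\overline{D^{t_2}g}$; the composition is $(D^{t_1}f,D^{t_2}g)_w=\frac{1}{\alpha_1}u_1D^{t_1}f-\frac1{\alpha_2}u_2D^{t_2}g$, where $\alpha_1=LC(D^{t_1}f)$, $\alpha_2=LC(D^{t_2}g)$. For $S\subseteq GDN(X)$ and $h\in GDN(X)$, $h\equiv0\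 mod(S,w)$ means that $h$ is a finite sum $\sum\beta_iu_iD^{t_i}s_i$ with $\beta_i\in k$, $u_i\in[D^\omega X]$, $t_i\in\mathbb{N}$, $s_i\in S$, $wt(\overline{u_iD^{t_i}s_i})=-1$ and $\overline{u_iD^{t_i}s_i}<w$. A composition $(D^{t_1}f,D^{t_2}g)_w$ is trivial if it is $\equiv0\ mod(S,w)$. A non-empty $S\subseteq GDN(X)$ is a Gröbner-Shirshov basis in $GDN(X)$ if all compositions of elements $f,g\in S$ (all $t_1,t_2$, all such $w$) are trivial. *)

(* Defs.v *)
From HB Require Import structures.
From mathcomp Require Import all_boot all_order all_algebra.
From mathcomp Require Import generic_quotient ring_quotient finmap monalg.
From mathcomp Require Import boolp classical_sets.
Set Implicit Arguments.
Unset Strict Implicit.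
Unset Printing Implicit Defensive.
Import Order.TTheory GRing.Theory Num.Theory.
Local Open Scope quotient_scope.
Local Open Scope ring_scope.

Notation "1" := (@mone _) : monom_scope.
Notation "u * v" := (mmul u v) : monom_scope.

Section LinearExtension.
Context {k : fieldType} {K : conomType} {V : lmodType k}.
Implicit Types (h : K -> V) (f g : {malg k[K]}) (u v w : K).

Definition malg_ext h f : V := \sum_(w <- msupp f) f@_w *: h w.

Fact malg_ext_wide h (A : {fset K}) f : (msupp f `<=` A)%fset ->
  malg_ext h f = \sum_(w <- A) f@_w *: h w.
Proof.
move=> sA; rewrite /malg_ext (big_fset_incl _ sA) // => w _.
by rewrite -mcoeff_eq0 => /eqP ->; rewrite scale0r.
Qed.

Fact malg_ext_linear h : linear (malg_ext h).
Proof.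
move=> c f g; pose A := (msupp (c *: f + g) `|` (msupp f `|` msupp g))%fset.
have sf : (msupp f `<=` A)%fset.
  exact: fsubset_trans (fsubsetUl _ _) (fsubsetUr _ _).
have sg : (msupp g `<=` A)%fset.
  exact: fsubset_trans (fsubsetUr _ _) (fsubsetUr _ _).
rewrite (@malg_ext_wide h A _ (fsubsetUl _ _)).
rewrite (@malg_ext_wide h A _ sf) (@malg_ext_wide h A _ sg).
rewrite scaler_sumr -big_split; apply: eq_bigr => w _ /=.
by rewrite mcoeffD mcoeffZ scalerDl scalerA.
Qed.

HB.instance Definition _ h := GRing.isLinear.Build k {malg k[K]} V *:%R
  (malg_ext h) (malg_ext_linear h).

Fact malg_extU h w : malg_ext h << w >> = h w.
Proof.
by rewrite /malg_ext msuppU oner_eq0 big_seq_fset1 mcoeffUU scale1r.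
Qed.

Fact malgE f : f = \sum_(w <- msupp f) f@_w *: << w >>.
Proof.
rewrite {1}[f]monalgE; apply: eq_bigr => w _; apply/malgP => v.
by rewrite mcoeffZ !mcoeffU mulr_natr.
Qed.

Fact malgUM u v : << u >> * << v >> = << (u * v)%M >> :> {malg k[K]}.
Proof. by rewrite malgM_def fgmulUU mulr1. Qed.

Fact malgUZl (c : k) u v :
  (c *: << u >>) * << v >> = c *: << (u * v)%M >> :> {malg k[K]}.
Proof. by rewrite -scalerAl malgUM. Qed.

Fact malgUZr (c : k) u v :
  << u >> * (c *: << v >>) = c *: << (u * v)%M >> :> {malg k[K]}.
Proof. by rewrite mulrC malgUZl [(v * u)%M]mulmC. Qed.

Fact malgUZ_eq n u v : (n != 0%N -> u = v) ->
  n%:R *: << u >> = n%:R *: << v >> :> {malg k[K]}.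
Proof. by case: n => [_|n ->]; rewrite // mulr0n !scale0r. Qed.

End LinearExtension.

Fact linear_leibniz {k : fieldType} {K : conomType}
    (E : {linear {malg k[K]} -> {malg k[K]}}) :
    (forall u v, E << (u * v)%M >> = E << u >> * << v >> + << u >> * E << v >>) ->
  forall f g, E (f * g) = E f * g + f * E g.
Proof.
move=> EM f g.
have Z a b x y : (a *: x) * (b *: y) = (a * b) *: (x * y) :> {malg k[K]}.
  by rewrite -scalerAl -scalerAr scalerA.
rewrite (malgE f) (malgE g) !mulr_suml 3!linear_sum mulr_suml -big_split /=.
apply: eq_bigr => u _; rewrite !mulr_sumr linear_sum -big_split /=.
apply: eq_bigr => v _; rewrite Z !linearZ /= !Z -scalerDr.
by rewrite malgUM EM.
Qed.

Fact malg_ext_leibniz {k : fieldType} {K : conomType} (h : K -> {malg k[K]}) :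
    (forall u v, h (u * v)%M = h u * << v >> + << u >> * h v) ->
  forall f g, malg_ext h (f * g) = malg_ext h f * g + f * malg_ext h g.
Proof.
move=> hM; apply: (@linear_leibniz k K (malg_ext h)) => u v /=.
by rewrite !malg_extU.
Qed.

Section Homogeneous.
Context {k : fieldType} {K : conomType} (wf : K -> int).
Implicit Types (f g : {malg k[K]}) (n : int) (w : K).

Definition homog n : {pred {malg k[K]}} :=
  fun f => all (fun w => wf w == n) (msupp f).

Fact homogP n f :
  reflect (forall w, w \in msupp f -> wf w = n) (f \in homog n).
Proof. by apply: (iffP allP) => H w /H => [/eqP|->]. Qed.

Fact homog_submod n : submod_closed (homog n).
Proof.
split=> [|c f g /homogP hf /homogP hg].
  by apply/homogP => w; rewrite msupp0 in_fset0.
apply/homogP => w; rewrite -mcoeff_neq0 mcoeffD mcoeffZ.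
have [/hf //|nf] := boolP (w \in msupp f).
have [/hg //|ng] := boolP (w \in msupp g).
by rewrite !mcoeff_outdom // mulr0 addr0 eqxx.
Qed.

HB.instance Definition _ n :=
  GRing.isSubmodClosed.Build k {malg k[K]} (homog n) (homog_submod n).

Fact homogU n w : wf w = n -> (<< w >> : {malg k[K]}) \in homog n.
Proof. by move=> e; apply/homogP => v; rewrite msuppU1 in_fset1 => /eqP ->. Qed.

Fact homog_ext m n (h : K -> {malg k[K]}) f :
    (forall w, wf w = m -> h w \in homog n) ->
  f \in homog m -> malg_ext h f \in homog n.
Proof.
move=> hh /homogP hf; rewrite /malg_ext big_seq rpred_sum // => w /hf wm.
by rewrite rpredZ // hh.
Qed.

Fact homogM m n f g : (forall u v, wf (u * v)%M = wf u + wf v) ->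
  f \in homog m -> g \in homog n -> f * g \in homog (m + n).
Proof.
move=> wM /homogP hf /homogP hg; apply/homogP => w /msuppM_le.
by case=> u [v [/hf <- /hg <- ->]].
Qed.

End Homogeneous.

Fact derivation_rsym {A : comNzRingType} {E : A -> A} :
    (forall x y, E (x * y) = E x * y + x * E y) ->
  forall x y z,
    E x * (E y * z) - E (E x * y) * z = E x * (E z * y) - E (E x * z) * y.
Proof.
move=> EM x y z.
have q b c : E x * (E b * c) - E (E x * b) * c = - (E (E x) * b * c).
  by rewrite EM mulrDl mulrA opprD addrCA subrr addr0.
by rewrite !q mulrAC.
Qed.

(* The letter a[i], with i >= -1, is the pair (i + 1, a), i.e. D^(i+1) a; the
   order on letters is the library's lexicographic order on pairs. *)
Notation letter X := (nat *l X)%type.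

Notation word X := {cmonom (letter X)}.

Notation diffalg k X := {malg k[word X]}.

Section Words.
Context {d : Order.disp_t} {X : orderType d}.
Implicit Types (l : letter X) (u v w : word X).

Definition next l : letter X := (l.1.+1, l.2).

Definition wt w : int := \sum_(l <- finsupp w) (l.1%:Z - 1) *+ w l.

Definition letters w : seq (letter X) :=
  sort >=%O (flatten [seq nseq (w l) l | l <- finsupp w]).

Definition ord w : nat *l seqlexi (letter X) := (mdeg w, letters w).

Definition wlt u v : bool := (ord u < ord v)%O.

Definition wmax u v : word X := if wlt u v then v else u.

Fact wt_wide (A : {fset letter X}) w : (finsupp w `<=` A)%fset ->
  wt w = \sum_(l <- A) (l.1%:Z - 1) *+ w l.
Proof.
move=> sA; rewrite /wt (big_fset_incl _ sA) // => l _.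
by rewrite -cmE_eq0 => /eqP ->; rewrite mulr0n.
Qed.

Fact wtM u v : wt (u * v)%M = wt u + wt v.
Proof.
have su := fsubsetUl (finsupp u) (finsupp v).
have sv := fsubsetUr (finsupp u) (finsupp v).
rewrite (wt_wide su) (wt_wide sv) /wt mdomD -big_split /=.
by apply: eq_bigr => l _; rewrite cmM mulrnDr.
Qed.

Fact wtU l : wt (ucm l) = l.1%:Z - 1.
Proof. by rewrite /wt mdomU big_seq_fset1 cmUU mulr1n. Qed.

Fact divcmK l w : w l != 0%N -> (divcm w (ucm l) * ucm l)%M = w.
Proof.
move=> wl; apply/eqP/cmP => i; rewrite cmM divcmE subnK // cmU.
by case: eqP => // <-; rewrite lt0n.
Qed.

Fact divcmMl l u v : u l != 0%N ->
  divcm (u * v)%M (ucm l) = (divcm u (ucm l) * v)%M.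
Proof.
move=> ul; apply/eqP/cmP => i; rewrite cmM !divcmE cmM addnBAC // cmU.
by case: eqP => // <-; rewrite lt0n.
Qed.

End Words.

Section DiffAlg.
Context {k : fieldType} {d : Order.disp_t} {X : orderType d}.
Local Notation kX := (diffalg k X).
Implicit Types (f g : kX) (u v w : word X) (l : letter X).

(* The Leibniz rule on a word: each letter l is replaced by its derivative, with
   multiplicity w l. *)
Definition Dword w : kX :=
  \sum_(l <- finsupp w) (w l)%:R *: << (divcm w (ucm l) * ucm (next l))%M >>.

Definition D : kX -> kX := malg_ext Dword.

(* The empty word is the least word, so it is a neutral element for wmax; the
   value at f = 0 is junk. *)
Definition lead f : word X := \big[wmax/1%M]_(w <- msupp f) w.

Definition LC f : k := f@_(lead f).

Fact Dword_wide (A : {fset letter X}) w : (finsupp w `<=` A)%fset ->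
  Dword w = \sum_(l <- A) (w l)%:R *: << (divcm w (ucm l) * ucm (next l))%M >>.
Proof.
move=> sA; rewrite /Dword (big_fset_incl _ sA) // => l _.
by rewrite -cmE_eq0 => /eqP ->; rewrite scale0r.
Qed.

Fact DwordM u v : Dword (u * v)%M = Dword u * << v >> + << u >> * Dword v.
Proof.
have su := fsubsetUl (finsupp u) (finsupp v).
have sv := fsubsetUr (finsupp u) (finsupp v).
rewrite (Dword_wide su) (Dword_wide sv) /Dword mdomD mulr_suml mulr_sumr.
rewrite -big_split; apply: eq_bigr => l _ /=.
rewrite cmM natrD scalerDl malgUZl malgUZr; apply: f_equal2.
  by apply: malgUZ_eq => ul; rewrite divcmMl // -!mulmA [(v * _)%M]mulmC.
apply: malgUZ_eq => vl; rewrite [(u * v)%M]mulmC divcmMl //.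
by rewrite [RHS]mulmC -!mulmA [(u * _)%M]mulmC.
Qed.

Fact D_letter l : D << ucm l >> = << ucm (next l) >>.
Proof.
have -> : ucm (next l) = (divcm (ucm l) (ucm l) * ucm (next l))%M.
  by apply/eqP/cmP => i; rewrite cmM divcmE subnn.
by rewrite /D malg_extU /Dword mdomU big_seq_fset1 cmUU scale1r.
Qed.

Fact D_one : D 1 = 0.
Proof. by rewrite /D malg_extU /Dword mdom1 big_seq_fset0. Qed.

Fact D_leibniz f g : D (f * g) = D f * g + f * D g.
Proof. exact: (malg_ext_leibniz DwordM f g). Qed.

Fact wt_Dterm l w : w l != 0%N ->
  wt (divcm w (ucm l) * ucm (next l))%M = wt w + 1.
Proof.
move=> wl; rewrite -[in RHS](divcmK wl) !wtM !wtU /= -addrA; congr (_ + _).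
by rewrite subrK intS addrC addKr.
Qed.

Fact D_homog (n : int) f : f \in homog wt n -> D f \in homog wt (n + 1).
Proof.
apply: homog_ext => w wn; rewrite /Dword big_seq rpred_sum // => l.
by rewrite -cmE_neq0 => wl; apply/rpredZ/homogU; rewrite wt_Dterm // wn.
Qed.

End DiffAlg.

Section GDNDef.
Context (k : fieldType) {d : Order.disp_t} (X : orderType d).

(* The span of the words of weight -1, words being a basis of k{X}. *)
Record GDN := MkGDN {
  gdn_val :> diffalg k X;
  _ : gdn_val \in homog wt (-1)
}.

HB.instance Definition _ := [isSub for gdn_val].
HB.instance Definition _ := [Choice of GDN by <:].
HB.instance Definition _ := [SubChoice_isSubLmodule of GDN by <:].

End GDNDef.

Section GDNAlgebra.
Context {k : fieldType} {d : Order.disp_t} {X : orderType d}.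
Local Notation kX := (diffalg k X).
Local Notation G := (GDN k X).
Implicit Types (f g h : G) (S : set G) (u v w : word X) (t : nat).

Fact gdn_mul_subproof f g : D f * g \in homog wt (-1).
Proof.
rewrite -[X in homog wt X]add0r; apply: homogM; first exact: wtM.
  by rewrite -[0](addNr 1); apply: D_homog; apply: valP.
exact: valP.
Qed.

Definition gdn_mul f g : G := MkGDN (gdn_mul_subproof f g).

(* The two defining identities of Gelfand-Dorfman-Novikov algebras. *)
Fact gdn_mul_rsym f g h :
  gdn_mul f (gdn_mul g h) - gdn_mul (gdn_mul f g) h =
  gdn_mul f (gdn_mul h g) - gdn_mul (gdn_mul f h) g.
Proof.
have vB (a b : G) : gdn_val (a - b) = gdn_val a - gdn_val b.
  exact: (raddfB val).
have vM (a b : G) : gdn_val (gdn_mul a b) = D a * b by [].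
have e (a b c : G) : gdn_val (gdn_mul a (gdn_mul b c) - gdn_mul (gdn_mul a b) c)
    = D a * (D b * c) - D (D a * b) * c.
  by rewrite vB (vM a (gdn_mul b c)) (vM b c) (vM (gdn_mul a b) c) (vM a b).
have r := derivation_rsym (D_leibniz (k := k) (X := X)).
exact: val_inj (etrans (e f g h) (etrans (r _ _ _) (esym (e f h g)))).
Qed.

Fact gdn_mul_lcomm f g h : gdn_mul f (gdn_mul g h) = gdn_mul g (gdn_mul f h).
Proof.
have r (A : comNzRingType) (x y z : A) : x * (y * z) = y * (x * z).
  exact: mulrCA.
apply: val_inj; exact: (r _ (D f) (D g) (gdn_val h)).
Qed.

Definition gdn_ideal (I : set G) : Prop :=
  [/\ I 0,
      (forall (c : k) f g, I f -> I g -> I (c *: f + g)),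
      (forall f g, I f -> I (gdn_mul f g)) &
      (forall f g, I f -> I (gdn_mul g f))].

Definition Id S : set G := smallest gdn_ideal S.

(* mem turns the set Id S into a boolean predicate (by classical choice), as
   the quotient construction requires. *)
Definition Id_mem S : {pred G} := mem (Id S).

Fact Id_memP S f : reflect (Id S f) (f \in Id_mem S).
Proof. exact: (iffP (asboolP _)). Qed.

Fact Id_ideal S : gdn_ideal (Id S).
Proof.
split=> [|c f g If Ig|f g If|f g If] J HJ; have [[J0 Jl Jr Jm] _] := HJ.
- exact: J0.
- exact: Jl (If _ HJ) (Ig _ HJ).
- exact: Jr (If _ HJ).
- exact: Jm (If _ HJ).
Qed.

Fact Id_submod S : submod_closed (Id_mem S).
Proof.
have [I0 Il _ _] := Id_ideal S.
split=> [|c f g /Id_memP If /Id_memP Ig]; apply/Id_memP => //.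
exact: Il.
Qed.

HB.instance Definition _ S :=
  GRing.isSubmodClosed.Build k G (Id_mem S) (Id_submod S).

(* GDN(X|S) = GDN(X)/Id(S); the library only makes the quotient by a subgroup
   an additive group, so the scaling is added here. *)
Definition GDN_quot S := Quotient.quot (Id_mem S).

HB.instance Definition _ S := GRing.Zmodule.on (GDN_quot S).
HB.instance Definition _ S := ZmodQuotient.on (GDN_quot S).

Definition quot_scale S (c : k) := lift_op1 (GDN_quot S) ( *:%R c).

Fact pi_quot_scale S c :
  {morph \pi_(GDN_quot S) : x / c *: x >-> quot_scale c x}.
Proof.
move=> x; unlock quot_scale; apply/eqP; rewrite -Quotient.idealrBE.
by rewrite -scalerBr rpredZ // Quotient.idealrBE reprK.
Qed.

Fact quot_scaleA S a b (x : GDN_quot S) :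
  quot_scale a (quot_scale b x) = quot_scale (a * b) x.
Proof. by rewrite -[x]reprK -!pi_quot_scale scalerA. Qed.

Fact quot_scale1 S : left_id 1 (@quot_scale S).
Proof. by move=> x; rewrite -[x]reprK -pi_quot_scale scale1r. Qed.

Fact quot_scaleDr S : right_distributive (@quot_scale S) +%R.
Proof.
move=> a x y; rewrite -[x]reprK -[y]reprK -!pi_quot_scale -!pi_addr /=.
by rewrite -pi_quot_scale scalerDr.
Qed.

Fact quot_scaleDl S x : {morph (@quot_scale S)^~ x : a b / a + b}.
Proof.
by move=> a b /=; rewrite -[x]reprK -!pi_quot_scale scalerDl pi_addr.
Qed.

HB.instance Definition _ S := GRing.Zmodule_isLmodule.Build k (GDN_quot S)
  (@quot_scaleA S) (@quot_scale1 S) (@quot_scaleDr S) (@quot_scaleDl S).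

Definition Dn t f : kX := iter t D (gdn_val f).

(* The word w as an element of GDN(X); it is only used when wt w = -1, and is
   0 otherwise. *)
Definition gdn_word w : G := insubd (0 : G) << w >>.

(* All uses of lead (Dn t f) below are guarded by Dn t f != 0, since lead 0 is
   junk. *)
Definition nontrivial_cm u v w : Prop :=
  [/\ wt w = -1, (exists u1, w = (u1 * u)%M), (exists u2, w = (u2 * v)%M) &
      forall w', w <> (u * v * w')%M].

(* The composition (D^t1 f, D^t2 g)_w for
   w = u1 * lead (Dn t1 f) = u2 * lead (Dn t2 g). *)
Definition composition t1 f t2 g u1 u2 : kX :=
  (LC (Dn t1 f))^-1 *: (<< u1 >> * Dn t1 f) -
  (LC (Dn t2 g))^-1 *: (<< u2 >> * Dn t2 g).

Definition trivial_mod S w (h : kX) : Prop :=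
  exists n (b : 'I_n -> k) (u : 'I_n -> word X) (t : 'I_n -> nat)
    (s : 'I_n -> G),
    (forall i, [/\ S (s i), Dn (t i) (s i) != 0,
      wt (lead (<< u i >> * Dn (t i) (s i))) = -1 &
      wlt (lead (<< u i >> * Dn (t i) (s i))) w]) /\
    h = \sum_(i < n) b i *: (<< u i >> * Dn (t i) (s i)).

Definition GS_basis S : Prop :=
  forall f g t1 t2 w u1 u2, S f -> S g -> Dn t1 f != 0 -> Dn t2 g != 0 ->
    nontrivial_cm (lead (Dn t1 f)) (lead (Dn t2 g)) w ->
    w = (u1 * lead (Dn t1 f))%M -> w = (u2 * lead (Dn t2 g))%M ->
    trivial_mod S w (composition t1 f t2 g u1 u2).

Definition ideal_lead S : Prop :=
  forall h, Id S h -> h != 0 ->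
    exists s u t, [/\ S s, Dn t s != 0 & lead h = (u * lead (Dn t s))%M].

Definition Irr S : set (word X) :=
  [set w | wt w = -1 /\ forall u t s, S s -> Dn t s != 0 ->
    w <> (u * lead (Dn t s))%M].

End GDNAlgebra.

(* The family (v i), for i in A, is a basis of V; in particular v is injective
   on A. *)
Definition linear_basis {k : fieldType} {V : lmodType k} {I : eqType}
    (A : set I) (v : I -> V) : Prop :=
  (forall (r : seq I) (c : I -> k), uniq r -> (forall i, i \in r -> A i) ->
     \sum_(i <- r) c i *: v i = 0 -> forall i, i \in r -> c i = 0) /\
  (forall x : V, exists (r : seq I) (c : I -> k),
     (forall i, i \in r -> A i) /\ x = \sum_(i <- r) c i *: v i).

(* Main.v *)
(* Inside k{X}, the ideal Id(S) is the span of the elements u D^t(s) with s in S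
   and wt(u) = -t.  For t = 0 the word u is built up by induction on its length
   and on the index of a letter, since b[j+1] v f = D(b[j] v) f - b[j] D(v) f;
   then t is raised with r D(f) a[-1] = D(r f) a[-1] - D(r) f a[-1].
   The order is compatible with multiplication, so each u D^t(s) with D^t(s) <> 0
   has leading word u lead(D^t(s)), and the rest is the Groebner-Shirshov argument
   with well-founded induction on words: under (i), two elements u D^t(s) with the
   same leading word w differ, once normalized, by a combination of such elements
   below w, so the largest leading word occurring in a representation of h in
   Id(S) can be lowered until it is that of h; conversely, and for (iii), leading
   words of the form u lead(D^t(s)) are subtracted one after the other. *)
Require Import Defs.
From mathcomp Require Import all_boot all_order all_algebra.
From mathcomp Require Import generic_quotient finmap monalg.
From mathcomp Require Import boolp classical_sets.
Set Implicit Arguments.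
Unset Strict Implicit.
Unset Printing Implicit Defensive.
Import Order.TTheory GRing.Theory Num.Theory.
Local Open Scope quotient_scope.
Local Open Scope classical_set_scope.
Local Open Scope ring_scope.

(** * Lexicographic order on nonincreasing sequences of a fixed length *)

Section LexicographicOrder.
Context {d : Order.disp_t} {T : orderType d}.
Implicit Types (x y : T) (s t : seqlexi T).

(** At the first difference the larger entry exceeds everything left in [s], and nothing beyond it
    is left in either sequence, so it is the witness. *)
Lemma lexi_count s t : sorted >=%O s -> sorted >=%O t -> size s = size t ->
  (s < t)%O -> exists2 x, (count_mem x s < count_mem x t)%N &
    forall y, (x < y)%O -> count_mem y s = count_mem y t.
Proof.
have tr : transitive (>=%O : rel T) by move=> x y z /= xy zx; apply: le_trans xy.
have gt0 x (r : seq T) : all (>=%O x) r -> forall y, (x < y)%O ->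
    count_mem y r = 0%N.
  move=> /allP xr y xy; apply/count_memPn/negP => /xr /= yx.
  by move: (lt_le_trans xy yx); rewrite ltxx.
elim: s t => [|x s IH] [|y t] //= sx ty [e]; rewrite ltxi_cons.
move: (sx) (ty); rewrite !(path_sortedE tr) => /andP[xs ss] /andP[yt st].
case: (ltgtP x y) => //= [xy _|-> lt].
  have {}xs : all (>=%O x) (x :: s) by rewrite /= lexx.
  have {}yt : all (>=%O y) (y :: t) by rewrite /= lexx.
  exists y => [|z yz]; last first.
    by rewrite -/(count_mem z (x :: s)) -/(count_mem z (y :: t))
               (gt0 _ _ xs) ?(lt_trans xy yz) // (gt0 _ _ yt).
  by rewrite -/(count_mem y (x :: s)) (gt0 _ _ xs) // eqxx.
have [z z1 z2] := IH t ss st e lt.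
by exists z => [|m /z2 ->] //; rewrite ltn_add2l.
Qed.

(** The sizes must agree: over letters a < b the chain b > ab > aab > ... never ends. At fixed size
    the induction is on the size, then the head, then the accessibility of the tail. *)
Lemma lexi_wf : well_founded (fun x y : T => (x < y)%O) -> forall t,
  Acc (fun a b : seqlexi T => size a = size b /\ (a < b)%O) t.
Proof.
move=> wfT t; move: {2}(size t) (erefl (size t)) => n; elim: n t => [|n IH] t.
  by move=> /size0nil ->; constructor => -[|x s] [].
case: t => [|x t] st; first by discriminate st.
have {}st : size t = n by case: st.
elim/(well_founded_ind wfT): x t st => x IHx t st.
have A := IH t st; elim: A st => {}t _ IHt st; constructor.
case=> [|y s] [es]; first by discriminate es.
have {}es : size s = size t by case: es.
rewrite ltxi_cons; case: (ltgtP y x) => [yx _|//|->].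
  by apply: (IHx y yx); rewrite es.
by rewrite implyTb => lt; apply: (IHt s (conj es lt)); rewrite es.
Qed.

End LexicographicOrder.

(** * The order on words: exponents, compatibility with products, well-foundedness *)

Section WordOrder.
Context {d : Order.disp_t} {X : orderType d}.
Implicit Types (l : letter X) (u v w : word X).

Lemma count_letters l w : count_mem l (letters w) = w l.
Proof.
rewrite /letters (permP (permEl (perm_sort _ _))).
have q (r : seq (letter X)) : uniq r ->
    count_mem l (flatten [seq nseq (w m) m | m <- r]) = ((l \in r) * w l)%N.
  elim: r => [|m r IH] //= /andP[nr ur].
  rewrite count_cat count_nseq IH // in_cons /= eq_sym.
  by case: eqVneq nr => //= <- /negPf ->; rewrite !mul1n addn0.
rewrite q ?fset_uniq // -cmE_neq0.
by case: eqVneq => [->|]; rewrite ?muln0 ?mul1n.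
Qed.

Lemma size_letters w : size (letters w) = mdeg w.
Proof.
rewrite /letters size_sort size_flatten /shape -map_comp mdegE sumnE big_map.
by apply: eq_bigr => l _; rewrite /= size_nseq.
Qed.

Lemma sorted_letters w : sorted >=%O (letters w).
Proof. by apply: sort_sorted => x y; apply: le_total. Qed.

Lemma letters_inj : injective (@letters d X).
Proof. by move=> u v e; apply/eqP/cmP => l; rewrite -!count_letters e. Qed.

Lemma ord_inj : injective (@ord d X).
Proof. by move=> u v [_ /letters_inj]. Qed.

(* This description of the order, unlike the sequences of letters, is visibly
   compatible with multiplication. *)
Definition exp_lt u v := exists2 l, (u l < v l)%N &
  forall m, (l < m)%O -> u m = v m.

Lemma exp_lt_asym u v : exp_lt u v -> exp_lt v u -> False.
Proof.
move=> [l ll lm] [m mm ml]; case: (ltgtP l m) => [lt|lt|e].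
- by move: mm; rewrite (lm _ lt) ltnn.
- by move: ll; rewrite (ml _ lt) ltnn.
by rewrite -e in mm; move: (ltn_trans ll mm); rewrite ltnn.
Qed.

Lemma wlt_deg_letters u v : wlt u v =
  (mdeg u < mdeg v)%N || (mdeg u == mdeg v) &&
    (letters u < letters v :> seqlexi (letter X))%O.
Proof.
rewrite /wlt /ord ltxi_pair !leEnat.
by case: (ltngtP (mdeg u) (mdeg v)).
Qed.

Lemma wlt_irr u : wlt u u = false. Proof. exact: ltxx. Qed.

Lemma wlt_trans v u w : wlt u v -> wlt v w -> wlt u w.
Proof. exact: lt_trans. Qed.

Lemma wlt_total u v : [\/ wlt u v, u = v | wlt v u].
Proof.
rewrite /wlt; case: (ltgtP (ord u) (ord v)) => [_|_|/ord_inj e].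
- by constructor 1.
- by constructor 3.
by constructor 2.
Qed.

(** Sequences are inspected in one direction only; the converse follows from totality of [wlt] and
    asymmetry of [exp_lt]. *)
Lemma wltP u v : wlt u v <->
  (mdeg u < mdeg v)%N \/ mdeg u = mdeg v /\ exp_lt u v.
Proof.
have C x y : mdeg x = mdeg y -> wlt x y -> exp_lt x y.
  move=> e; rewrite wlt_deg_letters e ltnn eqxx /= => lt.
  have es : size (letters x) = size (letters y) by rewrite !size_letters.
  have [l l1 l2] := lexi_count (sorted_letters x) (sorted_letters y) es lt.
  by exists l => [|m /l2]; rewrite -!count_letters.
split=> [lt|].
  move: (lt); rewrite wlt_deg_letters.
  by case/orP => [|/andP[/eqP e _]]; [left|right; split=> //; apply: C].
case=> [lt|[e lt]]; first by rewrite wlt_deg_letters lt.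
case: (wlt_total u v) => // [uv|vu].
  by rewrite -uv in lt; case: (exp_lt_asym lt lt).
by case: (exp_lt_asym lt (C _ _ (esym e) vu)).
Qed.

Lemma wlt_mulr w u v : wlt u v -> wlt (w * u)%M (w * v)%M.
Proof.
case/wltP => [lt|[e [l l1 l2]]]; apply/wltP; rewrite !mdegM.
  by left; rewrite ltn_add2l.
right; split; first by rewrite e.
by exists l => [|m /l2 em]; rewrite !cmM ?ltn_add2l // em.
Qed.

Lemma wmulI w : injective (mmul w).
Proof.
move=> u v /eqP/cmP e; apply/eqP/cmP => l; move: (e l); rewrite !cmM.
exact: addnI.
Qed.

(** Letters are compared within one length only, so after induction on the length [lexi_wf] takes
    over. *)
Lemma wlt_wf : well_founded (fun a b : X => (a < b)%O) ->
  well_founded (fun u v : word X => wlt u v).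
Proof.
move=> wfX.
have wfl : well_founded (fun l m : letter X => (l < m)%O).
  move=> [i a]; elim/ltn_ind: i a => i IHi a.
  elim/(well_founded_ind wfX): a => a IHa; constructor => -[j b].
  rewrite ltxi_pair !leEnat.
  case: (ltngtP j i) => [ji _|//|->]; first exact: IHi.
  by rewrite implyTb => /IHa.
move=> v; move: {2}(mdeg v) (erefl (mdeg v)) => n.
elim/ltn_ind: n v => n IHn v ev.
move: {2}(letters v) (erefl (letters v)) (lexi_wf wfl (letters v)) => s es A.
rewrite es in A; elim: A v ev es => {}s _ IHs v ev es; constructor => u.
rewrite wlt_deg_letters ev => /orP[lt|/andP[/eqP e lt]]; first exact: (IHn _ lt u erefl).
apply: (IHs (letters u)) => //; split; last by rewrite -es.
by rewrite -es !size_letters ev.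
Qed.

End WordOrder.

(** * Leading words and their behaviour under products and cancellation *)

Section Lead.
Context {k : fieldType} {d : Order.disp_t} {X : orderType d}.
Local Notation kX := (diffalg k X).
Implicit Types (f g : kX) (u v w : word X) (c : k).

Lemma msuppZD c f g w : w \in msupp (c *: f + g) ->
  w \in msupp f \/ w \in msupp g.
Proof.
rewrite -mcoeff_neq0 mcoeffD mcoeffZ.
have [|nf] := boolP (w \in msupp f); first by left.
have [|ng] := boolP (w \in msupp g); first by right.
by rewrite (mcoeff_outdom nf) (mcoeff_outdom ng) mulr0 addr0 eqxx.
Qed.

(** Multiplication by [u] is injective on words, so no two terms of [f] collide. *)
Lemma mcoeffUM u f v : (<< u >> * f)@_(u * v)%M = f@_v.
Proof.
rewrite malgM_def fgmulUg raddf_sum /=.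
transitivity (\sum_(w <- msupp f) f@_w *+ (w == v)).
  apply: eq_bigr => w _; rewrite mcoeffU mul1r.
  by rewrite (inj_eq (@wmulI _ _ u)).
transitivity ((\sum_(w <- msupp f) << f@_w *g w >>)@_v); last by rewrite -monalgE.
by rewrite raddf_sum; apply: eq_bigr => w _; rewrite /= mcoeffU.
Qed.

Lemma msuppUM u f w : w \in msupp (<< u >> * f) ->
  exists2 v, v \in msupp f & w = (u * v)%M.
Proof.
case/msuppM_le => v [v' [+ h ->]]; rewrite msuppU1 in_fset1 => /eqP ->.
by exists v'.
Qed.

Lemma malg_mem_neq0 f w : w \in msupp f -> f != 0.
Proof. by apply: contraTneq => ->; rewrite msupp0. Qed.

Lemma lead_in_max f : f != 0 -> lead f \in msupp f /\
  forall v, v \in msupp f -> v = lead f \/ wlt v (lead f).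
Proof.
move=> nz.
have q (r : seq (word X)) : r != [::] ->
    let m := \big[wmax/1%M]_(w <- r) w in
    m \in r /\ forall v, v \in r -> v = m \/ wlt v m.
  elim: r => [|u r IH] // _; rewrite big_cons /=.
  have [->|/IH/= [m1 m2]] := eqVneq r [::].
    rewrite big_nil; have -> : wmax u 1%M = u.
      rewrite /wmax; case: ifP => // lt.
      by case/wltP: lt => [|[e [l]]]; rewrite ?mdeg1 // cm1.
    rewrite mem_head; by split=> // v; rewrite inE => /eqP; left.
  rewrite /wmax; case: ifP => lt; rewrite !inE ?eqxx ?m1 ?orbT //.
    split=> // v; rewrite inE => /orP[/eqP ->|/m2] //; by right.
  split=> // v; rewrite inE => /orP[/eqP ->|/m2]; first by left.
  case: (wlt_total u (\big[wmax/1%M]_(w <- r) w)) lt => [->|e|gt] //.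
    by rewrite -e.
  by move=> _ [->|vm]; right => //; apply: wlt_trans vm gt.
rewrite /lead; apply: q; apply: contraNneq nz => e.
rewrite -msupp_eq0; apply/eqP/fsetP => w; rewrite in_fset0.
by apply: etrans (in_nil w); rewrite -e.
Qed.

Lemma lead_in f : f != 0 -> lead f \in msupp f.
Proof. by case/lead_in_max. Qed.

Lemma lead_max f v : v \in msupp f -> v = lead f \/ wlt v (lead f).
Proof. by move=> h; case: (lead_in_max (malg_mem_neq0 h)) => _; apply. Qed.

Lemma leadE w f : w \in msupp f ->
  (forall v, v \in msupp f -> v = w \/ wlt v w) -> lead f = w.
Proof.
move=> h wm; case: (wm _ (lead_in (malg_mem_neq0 h))) => // lt.
by case: (lead_max h) => // gt; move: (wlt_trans lt gt); rewrite wlt_irr.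
Qed.

Lemma LC_neq0 f : f != 0 -> LC f != 0.
Proof. by move/lead_in; rewrite mcoeff_neq0. Qed.

Lemma mulU_neq0 u f : f != 0 -> << u >> * f != 0.
Proof.
move=> nz; apply: (@malg_mem_neq0 _ (u * lead f)%M).
by rewrite -mcoeff_neq0 mcoeffUM LC_neq0.
Qed.

Lemma leadUM u f : f != 0 -> lead (<< u >> * f) = (u * lead f)%M.
Proof.
move=> nz; apply: leadE; first by rewrite -mcoeff_neq0 mcoeffUM LC_neq0.
move=> w /msuppUM[v vf ->]; case: (lead_max vf) => [->|lt]; first by left.
by right; apply: wlt_mulr.
Qed.

(** These bounds speak of the support and not of [lead f], so that they also hold for 0, where
    [lead] is junk. *)
Definition below w f := forall v, v \in msupp f -> wlt v w.
Definition upto w f := forall v, v \in msupp f -> v = w \/ wlt v w.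

Lemma below_upto w f : below w f -> upto w f.
Proof. by move=> h v /h; right. Qed.

Lemma upto_lead f : upto (lead f) f. Proof. exact: lead_max. Qed.

Lemma below0 w : below w 0.
Proof. by move=> v; rewrite msupp0 in_fset0. Qed.

Lemma belowZD w c f g : below w f -> below w g -> below w (c *: f + g).
Proof. by move=> hf hg v /msuppZD[/hf|/hg]. Qed.

Lemma upto_below w w' f : upto w f -> wlt w w' -> below w' f.
Proof. by move=> h lt v /h [->//|vw]; apply: wlt_trans vw lt. Qed.

Lemma upto_cancel w c f g : upto w f -> upto w g -> f@_w = c * g@_w ->
  below w (f - c *: g).
Proof.
move=> hf hg e v; rewrite addrC -scaleNr => h.
have nz : (- c *: g + f)@_v != 0 by rewrite mcoeff_neq0.
have: v = w \/ wlt v w by case/msuppZD: h => [/hg|/hf].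
case=> // ev; move: nz; rewrite ev mcoeffD mcoeffZ e mulNr addNr.
by rewrite eqxx.
Qed.

Lemma below_lead_neq w f : below w f -> f != 0 -> wlt (lead f) w.
Proof. by move=> h /lead_in/h. Qed.

End Lead.

(* Over an abstract monoid, unification does not unfold the monoid of words. *)
Section MonoidAlgebra.
Context {k : fieldType} {K : conomType}.
Implicit Types (c : k) (p q g : {malg k[K]}) (u v : K).

Lemma malg_mulZDl c p q g : (c *: p + q) * g = c *: (p * g) + q * g.
Proof. by rewrite mulrDl -scalerAl. Qed.

Lemma malg_mulZDr c p q g : g * (c *: p + q) = c *: (g * p) + g * q.
Proof. by rewrite mulrDr -scalerAr. Qed.

Lemma malg_mul0l g : 0 * g = 0. Proof. exact: mul0r. Qed.

Lemma malg_mul0r g : g * 0 = 0. Proof. exact: mulr0. Qed.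

Lemma malg_mul1l g : << 1%M >> * g = g. Proof. exact: mul1r. Qed.

Lemma malg_mulA p q g : p * (q * g) = p * q * g. Proof. exact: mulrA. Qed.

End MonoidAlgebra.

(** * Rearrangements of the Leibniz rule *)

Section Derivation.
Context {A : comNzRingType} {E : A -> A}.
Hypothesis EM : forall x y, E (x * y) = E x * y + x * E y.

Lemma derivM_mul x y z : E (x * y) * z = (E x * z) * y + (x * z) * E y.
Proof. by rewrite EM mulrDl; congr (_ + _); rewrite mulrAC. Qed.

(** With [x] a letter b[j], this trades b[j+1] for b[j]. *)
Lemma mul_derivl x y z : (E x * y) * z = E (x * y) * z - (x * E y) * z.
Proof. by rewrite EM mulrDl addrK. Qed.

(** With [y] = D^t(s) and [z] a letter a[-1], this passes from t to t+1. *)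
Lemma mul_derivr x y z : (z * x) * E y = E (x * y) * z - (E x * z) * y.
Proof. by rewrite derivM_mul [E x * z * y + _]addrC addrK [z * x]mulrC. Qed.

End Derivation.

(** * Weights, lengths, and the letters that a given weight forces *)

Section Homogeneity.
Context {k : fieldType} {d : Order.disp_t} {X : orderType d}.
Local Notation kX := (diffalg k X).
Implicit Types (f g p q : kX) (u v w : word X) (t : nat) (n : int) (c : k).

Lemma homogMw m n p q : p \in homog wt m -> q \in homog wt n ->
  p * q \in homog wt (m + n).
Proof. by apply: homogM; apply: wtM. Qed.

Lemma Dn_homog t (s : GDN k X) : Dn t s \in homog wt (t%:Z - 1).
Proof.
elim: t => [|t IH]; first exact: (valP s).
have -> : t.+1%:Z - 1 = t%:Z - 1 + 1 by rewrite subrK intS addrC addKr.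
exact: D_homog.
Qed.

Lemma wt_lead n f : f != 0 -> f \in homog wt n -> wt (lead f) = n.
Proof. by move=> /lead_in h /homogP; apply. Qed.

(** The derivation replaces one letter by one letter; this keeps induction on the length available
    after differentiating. *)
Lemma D_homog_deg n f : f \in homog (fun w => (mdeg w)%:Z) n ->
  D f \in homog (fun w : word X => (mdeg w)%:Z) n.
Proof.
apply: homog_ext => w wn; rewrite /Dword big_seq rpred_sum // => l.
rewrite -cmE_neq0 => wl; apply/rpredZ/homogU; rewrite -wn.
by rewrite -[in RHS](divcmK wl) !mdegM !mdegU.
Qed.

Lemma wt_le0 w : (forall l, w l != 0%N -> l.1 = 0%N) -> wt w = - (mdeg w)%:Z.
Proof.
move=> h; rewrite /wt mdegE big_seq [X in - Posz X]big_seq.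
rewrite (big_morph Posz (id1 := 0) (op1 := +%R)) // -sumrN.
apply: eq_bigr => l; rewrite -cmE_neq0 => /h ->.
by rewrite sub0r mulNrn -mulr_natr mul1r natz.
Qed.

(** If all letters were of the form a[-1], the weight would be minus the length. *)
Lemma exists_derived_letter w : wt w = 0 -> w != 1%M ->
  exists2 l, w l != 0%N & l.1 != 0%N.
Proof.
move=> w0 w1; apply: contrapT => nex.
have e : wt w = - (mdeg w)%:Z.
  apply: wt_le0 => l wl; apply/eqP; apply: contrapT => /negP l0.
  by apply: nex; exists l.
move: w1; rewrite -mdeg_eq0; apply/negP/negPn.
by move/eqP: e; rewrite w0 eq_sym oppr_eq0.
Qed.

Lemma exists_underived_letter w : wt w < 0 ->
  exists2 l, w l != 0%N & l.1 = 0%N.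
Proof.
move=> w0; apply: contrapT => nex; move: w0; apply/negP; rewrite -leNgt.
rewrite /wt big_seq; apply: sumr_ge0 => l; rewrite -cmE_neq0 => wl.
apply: mulrn_wge0; rewrite subr_ge0.
case: (eqVneq l.1 0%N) => [l0|]; first by case: nex; exists l.
by rewrite -lt0n.
Qed.

Lemma letter_divcm w l : w l != 0%N -> exists v, w = (ucm l * v)%M.
Proof.
by move=> wl; exists (divcm w (ucm l)); rewrite mulmC divcmK.
Qed.

End Homogeneity.

(** * Ideals of GDN(X) absorb multiplication by words of matching weight *)

Section IdealAction.
Context {k : fieldType} {d : Order.disp_t} {X : orderType d}.
Local Notation kX := (diffalg k X).
Implicit Types (f g p q : kX) (u v w : word X) (t : nat) (n : int) (c : k).

(* I plays the role of an ideal of GDN(X), seen inside k{X}. *)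
Variable I : kX -> Prop.
Hypothesis I0 : I 0.
Hypothesis IZD : forall c p q, I p -> I q -> I (c *: p + q).
Hypothesis IDl : forall p g, I p -> g \in homog wt (-1) -> I (D g * p).
Hypothesis IDr : forall p g, I p -> g \in homog wt (-1) -> I (D p * g).

Lemma ideal_sub p q : I p -> I q -> I (p - q).
Proof. by move=> Ip Iq; rewrite addrC -scaleN1r; apply: IZD. Qed.

Lemma ideal_mulZD c p q g : I (p * g) -> I (q * g) -> I ((c *: p + q) * g).
Proof. by move=> Ip Iq; rewrite malg_mulZDl; exact: (IZD c Ip Iq). Qed.

Lemma ideal_mul_supp p q : (forall w, w \in msupp q -> I (<< w >> * p)) ->
  I (q * p).
Proof.
move=> h; rewrite (malgE q) big_seq.
apply: (big_ind (fun x => I (x * p))) => [|x y Ix Iy|w wq].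
- by rewrite malg_mul0l.
- by rewrite -[x]scale1r; exact: (ideal_mulZD 1 Ix Iy).
rewrite -[_ *: _]addr0; apply: (ideal_mulZD _ (h w wq)).
by rewrite malg_mul0l.
Qed.

Lemma ideal_mul_homog n p : (forall w, wt w = n -> I (<< w >> * p)) ->
  forall q, q \in homog wt n -> I (q * p).
Proof. by move=> h q /homogP hq; apply: ideal_mul_supp => w /hq/h. Qed.

(** A nonempty word of weight 0 contains some a[i] with i >= 0. This letter is split off and its
    index lowered to 0, where a[0] = D(a[-1]) acts as a left multiplication in GDN(X). *)
Lemma ideal_mul_wt0 p u : I p -> wt u = 0 -> I (<< u >> * p).
Proof.
move=> Ip; move: {2}(mdeg u) (erefl (mdeg u)) => m.
elim: m u => [|m IHm] u um u0.
  by rewrite (mdeg_eq0I um) malg_mul1l.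
have [[i a] ul l0] : exists2 l, u l != 0%N & l.1 != 0%N.
  by apply: exists_derived_letter => //; rewrite -mdeg_eq0 um.
have [v uv] := letter_divcm ul; case: i l0 ul uv => // i _ _ uv.
have vm : mdeg v = m by move: um; rewrite uv mdegM mdegU => -[].
have vi : wt v = - i%:Z.
  move: u0; rewrite uv wtM wtU /= => /eqP; rewrite addrC addr_eq0 => /eqP ->.
  by rewrite intS addrAC subrr add0r.
(* The cofactor must be a polynomial, since the induction on [j] differentiates it; its fixed length
   [m] makes [IHm] available at [j = 0]. *)
have step : forall j q, q \in homog wt (- j%:Z) ->
    q \in homog (fun w => (mdeg w)%:Z) m%:Z ->
    I (<< ucm ((j.+1, a) : letter X) >> * q * p).
  elim=> [|j IHj] q qw qm.
    have e : D << ucm ((0%N, a) : letter X) >> = << ucm ((1%N, a) : letter X) >> :> kX.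
      exact: D_letter.
    rewrite -e -malg_mulA; apply: IDl; last by apply: homogU; rewrite wtU.
    apply: ideal_mul_supp => w wq; apply: IHm.
      by move/homogP: qm => /(_ _ wq) [].
    by move/homogP: qw => /(_ _ wq) ->; rewrite oppr0.
  have e : D << ucm ((j.+1, a) : letter X) >> = << ucm ((j.+2, a) : letter X) >> :> kX.
    exact: D_letter.
  rewrite -e (mul_derivl (E := D) (D_leibniz (k := k) (X := X))).
  have ej : - j%:Z = - j.+1%:Z + 1 by rewrite intS opprD addrAC addNr add0r.
  (* The product of a[j] and [q] has weight -1, so D of it times [p] is a left multiple of [p]; the
     other term has the lower index j. *)
  apply: ideal_sub.
    apply: (IDl Ip).
    have aw : (<< ucm ((j.+1, a) : letter X) >> : kX) \in homog wt (j.+1%:Z - 1).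
      by apply: homogU; rewrite wtU.
    by move: (homogMw aw qw); rewrite addrAC subrr add0r.
  apply: IHj; last exact: D_homog_deg.
  by rewrite ej; apply: D_homog.
rewrite uv -malgUM; apply: step; apply: homogU => //.
by rewrite vm.
Qed.

(** Negative weight forces a letter a[-1], so u = a[-1] v. By [mul_derivr], u D^(t+1)(s) is a right
    multiple by a[-1] of v D^t(s), minus D(v) a[-1] D^t(s), whose cofactor has weight -t. *)
Lemma ideal_mul_Dn (s : GDN k X) t : I (gdn_val s) ->
  forall q, q \in homog wt (- t%:Z) -> I (q * Dn t s).
Proof.
move=> Is; elim: t => [|t IH]; apply: ideal_mul_homog => u ut.
  by apply: ideal_mul_wt0; rewrite // ut oppr0.
have [[i a] ul /= i0] : exists2 l, u l != 0%N & l.1 = 0%N.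
  by apply: exists_underived_letter; rewrite ut oppr_lt0.
have [v uv] := letter_divcm ul; rewrite {}i0 in ul uv.
have vt : wt v = - t%:Z.
  move: ut; rewrite uv wtM wtU /= sub0r intS opprD => /addrI; exact.
have aw : (<< ucm ((0%N, a) : letter X) >> : kX) \in homog wt (-1).
  by apply: homogU; rewrite wtU.
rewrite uv -malgUM (mul_derivr (E := D) (D_leibniz (k := k) (X := X))).
apply: ideal_sub.
  by apply: IDr => //; apply: IH; apply: homogU.
apply: IH; have -> : - t%:Z = (- t%:Z + 1) + -1 by rewrite addrK.
by apply: homogMw aw; apply: D_homog; apply: homogU.
Qed.

End IdealAction.

Lemma sum_unlift (V : zmodType) n (x : V) (F : 'I_n -> V) :
  \sum_(i < n.+1) (if unlift ord0 i is Some j then F j else x) =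
  x + \sum_(i < n) F i.
Proof.
rewrite big_ord_recl unlift_none; congr (_ + _).
by apply: eq_bigr => i _; rewrite liftK.
Qed.

(** * The span of the elements u D^t(s) and its identification with Id(S) *)

Section Span.
Context {k : fieldType} {d : Order.disp_t} {X : orderType d}.
Local Notation kX := (diffalg k X).
Variable S : set (GDN k X).
Implicit Types (f g p q : kX) (u v w : word X) (t : nat) (n : int) (c : k).
Implicit Types (s : GDN k X) (Q : word X -> Prop).

(** [Q] constrains the leading words of the summands: [xpredT] yields Id(S), and the words below w
    yield triviality modulo (S,w). *)
Inductive span Q : kX -> Prop :=
| span0 : span Q 0
| span_add_term c u t s p : S s -> Dn t s != 0 ->
    wt (u * lead (Dn t s))%M = -1 -> Q (u * lead (Dn t s))%M ->
    span Q p -> span Q (c *: (<< u >> * Dn t s) + p).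

Definition term w p := exists u t s, [/\ S s, Dn t s != 0,
  w = (u * lead (Dn t s))%M, wt w = -1 & p = << u >> * Dn t s].

Lemma span_termZD Q c w p q : term w p -> Q w -> span Q q ->
  span Q (c *: p + q).
Proof. by case=> u [t [s [Ss nz -> ww ->]]] Qw sq; apply: span_add_term. Qed.

Lemma span_term Q w p : term w p -> Q w -> span Q p.
Proof.
move=> tp Qw; rewrite -[p]scale1r -[_ *: _]addr0.
exact: (span_termZD 1 tp Qw (span0 Q)).
Qed.

Lemma span_elim Q (P : kX -> Prop) : P 0 ->
    (forall c w p q, term w p -> Q w -> span Q q -> P q -> P (c *: p + q)) ->
  forall p, span Q p -> P p.
Proof.
move=> P0 PD p; elim=> // c u t s q Ss nz uw Qu sq Pq.
by apply: (PD c _ _ q _ Qu sq Pq); exists u, t, s.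
Qed.

Lemma spanZD Q c p q : span Q p -> span Q q -> span Q (c *: p + q).
Proof.
move=> sp sq; move: p sp; apply: span_elim => [|b w p r tp Qw _ IH].
  by rewrite scaler0 add0r.
by rewrite scalerDr scalerA -addrA; exact: (span_termZD (c * b) tp Qw IH).
Qed.

Lemma span_sum Q (J : eqType) (r : seq J) (F : J -> kX) :
  (forall j, j \in r -> span Q (F j)) -> span Q (\sum_(j <- r) F j).
Proof.
elim: r => [|j r IH] h; first by rewrite big_nil; exact: span0.
rewrite big_cons -[F j]scale1r; apply: (spanZD 1 (h j (mem_head j r))).
by apply: IH => i ir; apply: h; rewrite in_cons ir orbT.
Qed.

Lemma sub_span Q Q' p : (forall w, Q w -> Q' w) -> span Q p -> span Q' p.
Proof.
move=> h; move: p; apply: span_elim => [|c w p q tp /h Qw _ IH].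
  exact: span0.
exact: (span_termZD c tp Qw IH).
Qed.

Lemma term_lead w p : term w p ->
  [/\ p != 0, lead p = w, wt w = -1 & p \in homog wt (-1)].
Proof.
case=> u [t [s [Ss nz -> ww ->]]]; split=> //.
- exact: mulU_neq0.
- exact: leadUM.
have e : wt (lead (Dn t s)) = t%:Z - 1 by exact: (wt_lead nz (Dn_homog t s)).
have uh : (<< u >> : kX) \in homog wt (wt u) by apply: homogU.
by move: (homogMw uh (Dn_homog t s)); rewrite -e -wtM ww.
Qed.

Lemma term_coef w p : term w p -> p@_w != 0.
Proof. by case/term_lead => /LC_neq0 + <-. Qed.

Lemma span_homog Q p : span Q p -> p \in homog wt (-1).
Proof.
move: p; apply: span_elim => [|c w p q /term_lead[_ _ _ hp] _ _ hq].
  exact: rpred0.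
by apply: rpredD hq; exact: rpredZ.
Qed.

Lemma span_below w p : span (fun v => wlt v w) p -> below w p.
Proof.
move: p; apply: span_elim => [|c v p q /term_lead[_ e _ _] vw _ IH].
  exact: below0.
rewrite -e in vw.
exact: belowZD (upto_below (upto_lead (f := p)) vw) IH.
Qed.

Lemma trivial_modP w p : trivial_mod S w p <-> span (fun v => wlt v w) p.
Proof.
split.
  case=> n [b [u [t [s [h ->]]]]]; apply: span_sum => i _.
  have [Ss nz ww lw] := h i; rewrite -[_ *: _]addr0; rewrite leadUM // in ww lw.
  exact: span_add_term Ss nz ww lw (span0 _).
elim=> [|c u t s q Ss nz ww lw _ [n [b [u' [t' [s' [h ->]]]]]]].
  exists 0%N, (fun=> 0), (fun=> 1%M), (fun=> 0%N), (fun=> 0).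
  by split=> [[]|]; rewrite ?big_ord0.
(* [ex] puts a new head in front of a family indexed by ['I_n]. *)
pose ex (T : Type) (x : T) (F : 'I_n -> T) (i : 'I_n.+1) :=
  if unlift ord0 i is Some j then F j else x.
exists n.+1, (ex _ c b), (ex _ u u'), (ex _ t t'), (ex _ s s'); split.
  move=> i; rewrite /ex; case: unliftP => [j _|_]; first exact: h.
  by rewrite leadUM.
rewrite -(sum_unlift (c *: (<< u >> * Dn t s))
  (fun i => b i *: (<< u' i >> * Dn (t' i) (s' i)))).
by apply: eq_bigr => i _; rewrite /ex; case: (unlift ord0 i) => [j|].
Qed.

(** A representation has finitely many summands, so one of their leading words is the largest; the
    descent in [GS_lead] starts there. *)
Lemma span_max Q p : span Q p -> p = 0 \/
  exists2 w, Q w & span (fun v => v = w \/ wlt v w) p.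
Proof.
move: p; apply: span_elim => [|c w p q tp Qw _ IH]; first by left.
right; case: IH => [->|[v Qv sq]].
  exists w => //; have Qw' : w = w \/ wlt w w by left.
  exact: (span_termZD c tp Qw' (span0 _)).
case: (wlt_total w v) => [lt|e|lt].
- by exists v => //; apply: (span_termZD c tp _ sq); right.
- by exists v => //; apply: (span_termZD c tp _ sq); left.
exists w => //; apply: (span_termZD c tp); first by left.
apply: sub_span sq => x [->|xv]; right=> //; exact: wlt_trans lt.
Qed.

(** The case D^t(s) = 0 is absorbed here, so that closure under products needs no nonvanishing
    condition. *)
Lemma span_UDn u t s : S s -> wt u = - t%:Z -> span xpredT (<< u >> * Dn t s).
Proof.
move=> Ss ut; have [->|nz] := eqVneq (Dn t s) 0.
  by rewrite malg_mul0r; exact: span0.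
apply: (@span_term _ (u * lead (Dn t s))%M) => //; exists u, t, s; split=> //.
by rewrite wtM ut (wt_lead nz (Dn_homog t s)) addKr.
Qed.

Lemma span_mulDn q t s : S s -> q \in homog wt (- t%:Z) ->
  span xpredT (q * Dn t s).
Proof.
move=> Ss; apply: (ideal_mul_homog (span0 _) (@spanZD _)) => u.
exact: span_UDn.
Qed.

Lemma termE w p : term w p ->
  exists u t s, [/\ S s, wt u = - t%:Z & p = << u >> * Dn t s].
Proof.
case=> u [t [s [Ss nz -> ww ->]]]; exists u, t, s; split=> //.
move: ww; rewrite wtM (wt_lead nz (Dn_homog t s)) addrA => /eqP.
by rewrite -[-1]add0r (inj_eq (addIr _)) addr_eq0 => /eqP.
Qed.

(** With q = D(g) this is closure under left multiplication by g in GDN(X). *)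
Lemma span_mul0 p q : span xpredT p -> q \in homog wt 0 ->
  span xpredT (q * p).
Proof.
move=> sp q0; move: p sp; apply: span_elim => [|c w p r /termE + _ _ IH].
  by rewrite malg_mul0r; exact: span0.
case=> u [t [s [Ss ut ->]]]; rewrite malg_mulZDr; apply: (spanZD c _ IH).
rewrite malg_mulA; apply: span_mulDn => //; rewrite -[- _]add0r.
have uh : (<< u >> : kX) \in homog wt (- t%:Z) by apply: homogU.
exact: (homogMw q0 uh).
Qed.

(** Closure under right multiplication: D(u D^t(s)) g = D(u) g D^t(s) + u g D^(t+1)(s), and both
    cofactors have the required weight. *)
Lemma span_mulD p g : span xpredT p -> g \in homog wt (-1) ->
  span xpredT (D p * g).
Proof.
move=> sp g1; move: p sp; apply: span_elim => [|c w p r /termE + _ _ IH].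
  by rewrite /D linear0 malg_mul0l; exact: span0.
case=> u [t [s [Ss ut ->]]]; rewrite /D linearP malg_mulZDl -/D.
apply: (spanZD c _ IH).
rewrite (derivM_mul (E := D) (D_leibniz (k := k) (X := X))) -[X in X + _]scale1r.
have uh : (<< u >> : kX) \in homog wt (- t%:Z) by apply: homogU.
apply: spanZD; last first.
  apply: (@span_mulDn _ t.+1) => //; rewrite intS opprD addrC.
  exact: (homogMw uh g1).
apply: span_mulDn => //; rewrite -[- _](addrK 1).
exact: (homogMw (D_homog uh) g1).
Qed.

Lemma Id_span s : Id S s -> span xpredT (gdn_val s).
Proof.
move=> Is; apply: (Is (fun s => span xpredT (gdn_val s))); split.
  split=> [|c f g If Ig|f g If|f g Ig].
  - exact: span0.
  - exact: spanZD.
  - exact: span_mulD If (valP g).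
  apply: (span_mul0 Ig); exact: (D_homog (valP g)).
move=> f Sf; rewrite -[gdn_val f]malg_mul1l; apply: (@span_UDn _ 0%N) => //.
by rewrite /wt mdom1 big_seq_fset0 oppr0.
Qed.

Lemma span_Id p : span xpredT p -> exists2 s, Id S s & gdn_val s = p.
Proof.
(* [I] is the image of Id(S) in k{X}, to which the section on ideal actions applies. *)
pose I p := exists2 s, Id S s & gdn_val s = p.
have [J0 JD Jr Jl] := Id_ideal S.
have I0 : I 0 by exists 0.
have IZD c q r : I q -> I r -> I (c *: q + r).
  by case=> f If <- [g Ig <-]; exists (c *: f + g) => //; exact: JD.
move: p; apply: span_elim => [//|c w p q /termE[u [t [s [Ss ut ->]]]] _ _ Iq].
apply: (IZD _ _ _ _ Iq); apply: (ideal_mul_Dn I0 IZD).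
- move=> r g [f If <-] gw; exists (gdn_mul (MkGDN gw) f) => //; exact: Jl.
- move=> r g [f If <-] gw; exists (gdn_mul f (MkGDN gw)) => //; exact: Jr.
- by exists s => // J [_]; apply.
exact: homogU.
Qed.

End Span.

(** With [a] and [b] the coefficients of [x] and [y] at a common leading word, [c *: x] is exchanged
    for a multiple of [y] at the cost of a normalized difference. *)
Lemma eliminate_scaled (k : fieldType) (V : lmodType k) (a b c e : k) (x y z : V) :
  a != 0 ->
  c *: x + z - (e + c * a * b^-1) *: y =
  (c * a) *: (a^-1 *: x - b^-1 *: y) + (z - e *: y).
Proof.
move=> a0; rewrite scalerBr !scalerA mulfK // scalerDl opprD.
by rewrite -!addrA; congr (_ + _); rewrite addrA addrC.
Qed.

(* With A = x a + A' and B = y b + B', the leading parts of b W A / x and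
   a W B / y cancel, and what remains is (A' W B - B' W A) / (x y). *)
Lemma trivial_composition (k : fieldType) (R : comAlgType k) (x y : k)
    (a b W A B : R) : x != 0 -> y != 0 ->
  x^-1 *: (b * W * A) - y^-1 *: (a * W * B) =
  (x^-1 * y^-1) *: ((A - x *: a) * (W * B)) +
  (- (x^-1 * y^-1)) *: ((B - y *: b) * (W * A)).
Proof.
move=> x0 y0; rewrite scaleNr -scalerBr !mulrBl.
have -> : A * (W * B) = B * (W * A) by rewrite mulrCA [RHS]mulrCA [A * B]mulrC.
have E (P Q T : R) : P - Q - (P - T) = T - Q by rewrite opprB addrC addrA subrK.
rewrite E scalerBr -!scalerAl !scalerA.
by rewrite mulfVK // [x^-1 * y^-1]mulrC mulfVK // !mulrA.
Qed.

(** * Equivalence of (i) and (ii) *)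

Section CompositionDiamond.
Context {k : fieldType} {d : Order.disp_t} {X : orderType d}.
Local Notation kX := (diffalg k X).
Variable S : set (GDN k X).
Hypothesis wfX : well_founded (fun a b : X => (a < b)%O).
Implicit Types (f g p q : kX) (u v w : word X) (t : nat) (n : int) (c : k).
Implicit Types (s : GDN k X).

Lemma mcoeff_below w f : below w f -> f@_w = 0.
Proof.
move=> bf; apply: mcoeff_outdom; apply/negP => /bf; by rewrite wlt_irr.
Qed.

Lemma mcoeffUM_lead u f w : w = (u * lead f)%M -> (<< u >> * f)@_w = LC f.
Proof. by move=> ->; exact: mcoeffUM. Qed.

Lemma below_normalized w p q (a b : k) : upto w p -> upto w q ->
  p@_w = a -> q@_w = b -> a != 0 -> b != 0 ->
  below w (a^-1 *: p - b^-1 *: q).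
Proof.
move=> up uq pa qb a0 b0; apply: upto_cancel => //.
  move=> v; rewrite -[_ *: _]addr0 => /msuppZD[/up|] //.
  by rewrite msupp0 in_fset0.
by rewrite mcoeffZ pa qb !mulVf.
Qed.

(** Each word v of [f] lies below [a] and has its weight, so v w' D^t(s) is an admissible summand
    whose leading word is below [w]. *)
Lemma mul_below_span w w' a t s f : S s -> Dn t s != 0 ->
    w = (a * w' * lead (Dn t s))%M -> wt w = -1 ->
    f \in homog wt (wt a) -> below a f ->
  span S (fun v => wlt v w) (f * (<< w' >> * Dn t s)).
Proof.
move=> Ss nz ew ww fa bf.
apply: (ideal_mul_supp (span0 _ _) (@spanZD _ _ _ _ _)) => v vf.
have va : wt v = wt a by move/homogP: fa; apply.
rewrite malg_mulA malgUM.
have lt : wlt (v * w' * lead (Dn t s))%M w.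
  by rewrite ew -!mulmA [(v * _)%M]mulmC [(a * _)%M]mulmC; apply/wlt_mulr/bf.
apply: (@span_term _ _ _ _ _ (v * w' * lead (Dn t s))%M _ _ lt).
exists (v * w')%M, t, s; split=> //.
by rewrite -ww ew !wtM va.
Qed.

Lemma lead_part_homog n p : p != 0 -> p \in homog wt n ->
  p - LC p *: << lead p >> \in homog wt (wt (lead p)).
Proof.
move=> nz hp; rewrite (wt_lead nz hp); apply: rpredB => //.
by apply: rpredZ; apply: homogU; apply: wt_lead hp.
Qed.

Lemma lead_part_below p : below (lead p) (p - LC p *: << lead p >>).
Proof.
apply: upto_cancel; first exact: upto_lead.
  by move=> v; rewrite msuppU1 in_fset1 => /eqP; left.
by rewrite mcoeffUU mulr1.
Qed.

(** If [w] is a multiple of the product of both leading words, [trivial_composition] rewrites the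
    difference with smaller summands; otherwise the difference is a composition, trivial by
    assumption. *)
Lemma GS_terms w p q : GS_basis S -> term S w p -> term S w q ->
  span S (fun v => wlt v w) ((p@_w)^-1 *: p - (q@_w)^-1 *: q).
Proof.
move=> GS [u1 [t1 [s1 [S1 nz1 e1 ww ep]]]] [u2 [t2 [s2 [S2 nz2 e2 _ eq]]]].
have -> : p@_w = LC (Dn t1 s1) by rewrite ep; exact: mcoeffUM_lead.
have -> : q@_w = LC (Dn t2 s2) by rewrite eq; exact: mcoeffUM_lead.
rewrite {}ep {}eq.
case: (pselect (exists w', w = (lead (Dn t1 s1) * lead (Dn t2 s2) * w')%M)).
  case=> w' ew.
  (* Cancelling the leading word of D^t1(s1) from both factorizations of [w] determines [u1]. *)
  have -> : u1 = (lead (Dn t2 s2) * w')%M.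
    apply: (@wmulI _ _ (lead (Dn t1 s1))); rewrite mulmA -ew mulmC; exact: esym e1.
  have -> : u2 = (lead (Dn t1 s1) * w')%M.
    apply: (@wmulI _ _ (lead (Dn t2 s2))).
    by rewrite mulmA [(lead (Dn t2 s2) * lead _)%M]mulmC -ew mulmC; exact: esym e2.
  rewrite -!malgUM trivial_composition ?LC_neq0 //.
  apply: spanZD.
    apply: (mul_below_span S2 nz2 _ ww (lead_part_homog nz1 (Dn_homog _ _))).
      by rewrite ew -!mulmA [(w' * _)%M]mulmC.
    exact: lead_part_below.
  rewrite -[_ *: _]addr0; apply: spanZD; last exact: span0.
  apply: (mul_below_span S1 nz1 _ ww (lead_part_homog nz2 (Dn_homog _ _))).
    by rewrite ew -mulmA mulmC.
  exact: lead_part_below.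
move=> nex; apply/trivial_modP; apply: (GS _ _ _ _ w) => //; split=> //.
- by exists u1.
- by exists u2.
by move=> w' e; apply: nex; exists w'.
Qed.

(** All summands with leading word [w] are merged into a multiple of a single one by [GS_terms]. *)
Lemma GS_head w h : GS_basis S -> span S (fun v => v = w \/ wlt v w) h ->
  span S (fun v => wlt v w) h \/
  exists c p, term S w p /\ span S (fun v => wlt v w) (h - c *: p).
Proof.
move=> GS; move: h; apply: span_elim => [|c v p q tp vw _ IH].
  by left; exact: span0.
case: vw tp => [->|vw] tp.
  right; case: IH => [sq|[e [p' [tp' sq]]]].
    exists c, p; split; first exact: tp.
    by rewrite addrAC subrr add0r.
  (* This is [e] plus the multiple of [p'] that has the same coefficient at [w] as [c *: p]. *)
  exists (e + c * p@_w * (p'@_w)^-1), p'; split; first exact: tp'.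
  rewrite (eliminate_scaled (p'@_w) c e p p' q (term_coef tp)).
  exact: (spanZD _ (GS_terms GS tp tp') sq).
case: IH => [sq|[e [p' [tp' sq]]]].
  left; exact: (span_termZD c tp vw sq).
right; exists e, p'; split; first exact: tp'.
rewrite -addrA.
exact: (span_termZD c tp vw sq).
Qed.

Lemma GS_lead h : GS_basis S -> span S xpredT h -> h != 0 ->
  exists p, term S (lead h) p.
Proof.
move=> GS sh hn0.
case: (span_max sh) => [h0|[w _]]; first by rewrite h0 eqxx in hn0.
move=> {}sh; move: w h sh hn0; apply: (well_founded_ind (wlt_wf wfX)) => w IH h sh hn0.
have low : span S (fun v => wlt v w) h -> exists p, term S (lead h) p.
  case/span_max => [h0|[v vw sv]]; first by rewrite h0 eqxx in hn0.
  exact: (IH v vw h sv hn0).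
case: (GS_head GS sh) => // -[c [p [tp sp]]].
(* If the merged coefficient vanishes the bound [w] drops; otherwise nothing cancels [w], which is
   then the leading word of [h]. *)
have [c0|c0] := eqVneq c 0; first by apply: low; rewrite c0 scale0r subr0 in sp.
have bw := span_below sp.
have [_ lp _ _] := term_lead tp.
have hw : h@_w = c * p@_w.
  by move: (mcoeff_below bw); rewrite mcoeffB mcoeffZ => /eqP; rewrite subr_eq0 => /eqP.
suff -> : lead h = w by exists p.
have up : upto w p by rewrite -lp; exact: upto_lead.
apply: leadE => [|v].
  by rewrite -mcoeff_neq0 hw mulf_neq0 // (term_coef tp).
rewrite -[h](subrK (c *: p)) addrC => /msuppZD[/up|/bw] //; by right.
Qed.

Lemma ideal_lead_term h : ideal_lead S -> span S xpredT h -> h != 0 ->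
  exists p, term S (lead h) p.
Proof.
move=> il sh; have [s Is es] := span_Id sh; rewrite -es => nz.
have [|s' [u [t [Ss' nz' e]]]] := il s Is.
  by apply: contraNneq nz => ->.
exists (<< u >> * Dn t s'), u, t, s'; split=> //.
by apply: wt_lead => //; exact: (valP s).
Qed.

Lemma term_ideal_lead : (forall h, span S xpredT h -> h != 0 ->
  exists p, term S (lead h) p) -> ideal_lead S.
Proof.
move=> H s Is s0; have [|p [u [t [s' [Ss nz e _ _]]]]] := H _ (Id_span Is).
  by apply: contraNneq s0 => e; apply/eqP; apply: val_inj.
by exists s', u, t.
Qed.

Lemma GS_ideal_lead : GS_basis S -> ideal_lead S.
Proof. by move=> GS; apply: term_ideal_lead => h; apply: GS_lead. Qed.

(** Division by leading words: each subtracted summand has the current leading word, and these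
    decrease while staying below [w]. *)
Lemma ideal_lead_span w h : ideal_lead S -> span S xpredT h -> below w h ->
  span S (fun v => wlt v w) h.
Proof.
move=> il sh bh; have [->|h0] := eqVneq h 0; first exact: span0.
move: {2}(lead h) (erefl (lead h)) => v; move: v h h0 sh bh.
apply: (well_founded_ind (wlt_wf wfX)) => v IH h h0 sh bh ev.
have [p tp] := ideal_lead_term il sh h0.
have [_ lp _ _] := term_lead tp; pose c := h@_v / p@_v.
have vw : wlt v w by rewrite -ev; exact: (below_lead_neq bh h0).
rewrite ev in tp lp.
have b' : below v (h - c *: p).
  have hv : upto v h by rewrite -ev; exact: upto_lead.
  have pv : upto v p by rewrite -lp; exact: upto_lead.
  apply: (upto_cancel hv pv).
  by rewrite /c divfK // (term_coef tp).
rewrite -[h](subrK (c *: p)) addrC; apply: (span_termZD c tp vw).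
have [->|h'0] := eqVneq (h - c *: p) 0; first exact: span0.
have lt := below_lead_neq b' h'0.
apply: (IH _ lt _ h'0) => //.
- rewrite -scaleNr addrC; apply: (spanZD _ _ sh); exact: (span_term tp).
by move=> x /b' xv; exact: wlt_trans vw.
Qed.

(** A composition lies in Id(S), and its two normalized parts cancel at [w], so division represents
    it below [w]. *)
Lemma ideal_lead_GS : ideal_lead S -> GS_basis S.
Proof.
move=> il f g t1 t2 w u1 u2 Sf Sg nz1 nz2 [ww _ _ _] e1 e2.
have tp : term S w (<< u1 >> * Dn t1 f) by exists u1, t1, f.
have tq : term S w (<< u2 >> * Dn t2 g) by exists u2, t2, g.
have up p : term S w p -> upto w p.
  by case/term_lead => _ <- _ _; exact: upto_lead.
apply/trivial_modP; apply: (ideal_lead_span il).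
  rewrite /composition -scaleNr; apply: spanZD; first exact: (span_term tp).
  by rewrite -[_ *: _]addr0; exact: (span_termZD _ tq isT (span0 _ _)).
exact: (below_normalized (up _ tp) (up _ tq) (mcoeffUM_lead e1)
  (mcoeffUM_lead e2) (LC_neq0 nz1) (LC_neq0 nz2)).
Qed.

End CompositionDiamond.

(** * Normal forms modulo Id(S) and equivalence of (ii) and (iii) *)

Section NormalForms.
Context {k : fieldType} {d : Order.disp_t} {X : orderType d}.
Local Notation kX := (diffalg k X).
Local Notation G := (GDN k X).
Variable S : set G.
Hypothesis wfX : well_founded (fun a b : X => (a < b)%O).
Implicit Types (f g p q : kX) (u v w : word X) (t : nat) (n : int) (c : k).
Implicit Types (s : G) (r : seq (word X)).

Lemma Irr_or_term w : wt w = -1 -> Irr S w \/ exists p, term S w p.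
Proof.
move=> ww; case: (pselect (exists p, term S w p)) => [|nt]; [by right|left].
split=> // u t s Ss nz e; apply: nt.
by exists (<< u >> * Dn t s), u, t, s.
Qed.

Lemma Irr_no_term w p : Irr S w -> ~ term S w p.
Proof. by case=> _ h [u [t [s [Ss nz /h-/(_ Ss nz)]]]]. Qed.

(** Terms are treated from the largest word downwards: irreducible ones are kept, the others
    reduced. The last clause ensures that an irreducible leading word survives, as [free_ideal_lead]
    requires. *)
Lemma normal_form v h : h \in homog wt (-1) -> upto v h ->
  exists f, [/\ forall w, w \in msupp f -> Irr S w, upto v f,
    span S xpredT (h - f) & Irr S v -> f@_v = h@_v].
Proof.
move: v h; apply: (well_founded_ind (wlt_wf wfX)) => v IH h hh hv.
have low g : g \in homog wt (-1) -> below v g ->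
    exists f, [/\ forall w, w \in msupp f -> Irr S w, below v f &
      span S xpredT (g - f)].
  move=> gh gv; have [->|g0] := eqVneq g 0.
    exists 0; split; [|exact: below0|by rewrite subrr; exact: span0].
    by move=> w; rewrite msupp0 in_fset0.
  have lt := below_lead_neq gv g0.
  have [f [fI fu fs _]] := IH _ lt g gh (@upto_lead _ _ _ g).
  exists f; split=> //; exact: upto_below fu lt.
(* A bound [v] of another weight cannot occur in [h], so [h] is already below it. *)
have [wv|wv] := eqVneq (wt v) (-1); last first.
  have bh : below v h.
    move=> w wh; case: (hv w wh) => // e; move/homogP: hh => /(_ _ wh).
    by rewrite e => ev; rewrite ev eqxx in wv.
  have [f [fI fb fs]] := low h hh bh; exists f; split=> //.
    exact: below_upto.
  by case=> e _; rewrite e eqxx in wv.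
case: (Irr_or_term wv) => [vI|[p tp]].
  have Uv : upto v (<< v >> : kX).
    by move=> w; rewrite msuppU1 in_fset1 => /eqP; left.
  have cv : h@_v = h@_v * (<< v >> : kX)@_v by rewrite mcoeffUU mulr1.
  have hh' : h - h@_v *: << v >> \in homog wt (-1).
    by apply: rpredB => //; apply: rpredZ; apply: homogU.
  have [f [fI fb fs]] := low _ hh' (upto_cancel hv Uv cv).
  exists (h@_v *: << v >> + f); split.
  - move=> w /msuppZD[|/fI//]; by rewrite msuppU1 in_fset1 => /eqP ->.
  - by move=> w /msuppZD[/Uv|/fb]; [|right].
  - by rewrite opprD addrA.
  by move=> _; rewrite mcoeffD mcoeffZ -cv (mcoeff_below fb) addr0.
have [p0 lp _ ph] := term_lead tp.
have pv : upto v p by rewrite -lp; exact: upto_lead.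
have cv : h@_v = (h@_v / p@_v) * p@_v by rewrite divfK // (term_coef tp).
have hh' : h - (h@_v / p@_v) *: p \in homog wt (-1).
  by apply: rpredB => //; apply: rpredZ.
have [f [fI fb fs]] := low _ hh' (upto_cancel hv pv cv).
exists f; split=> //; first exact: below_upto.
  rewrite -[h](subrK ((h@_v / p@_v) *: p)) addrAC addrC.
  exact: (span_termZD _ tp isT fs).
by move=> /Irr_no_term/(_ tp).
Qed.

Lemma gdn_word_val w : wt w = -1 -> gdn_val (gdn_word w : G) = << w >>.
Proof. by move=> ww; apply: insubdK; exact: homogU. Qed.

Lemma gdn_sum_val r (c : word X -> k) : (forall w, w \in r -> wt w = -1) ->
  gdn_val (\sum_(w <- r) c w *: (gdn_word w : G)) =
  \sum_(w <- r) c w *: << w >>.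
Proof.
elim: r => [|w r IH] h; first by rewrite !big_nil.
rewrite !big_cons -IH => [|v vr]; last by apply: h; rewrite in_cons vr orbT.
by rewrite -(gdn_word_val (h w (mem_head w r))).
Qed.

Lemma pi_lincomb r (c : word X -> k) (F : word X -> G) :
  \pi_(GDN_quot S) (\sum_(w <- r) c w *: F w) =
  \sum_(w <- r) c w *: (\pi_(GDN_quot S) (F w) : GDN_quot S).
Proof.
elim: r => [|w r IH]; first by rewrite !big_nil; exact: pi_zeror.
rewrite !big_cons -IH pi_addr; congr (_ + _); exact: pi_quot_scale.
Qed.

Lemma pi_eq (x y : G) :
  \pi_(GDN_quot S) x = \pi_(GDN_quot S) y <-> Id S (x - y).
Proof.
split=> [e|/Id_memP h]; first by apply/Id_memP; rewrite Quotient.idealrBE e.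
by apply/eqP; rewrite -Quotient.idealrBE.
Qed.

Lemma mcoeff_lincomb r (c : word X -> k) w : uniq r ->
  (\sum_(v <- r) c v *: (<< v >> : kX))@_w = if w \in r then c w else 0.
Proof.
elim: r => [|v r IH] /=; first by rewrite big_nil mcoeff0.
case/andP=> nr ur; rewrite big_cons mcoeffD mcoeffZ mcoeffU1 (IH ur) in_cons.
rewrite [w == v]eq_sym; case: eqVneq nr => [->|_ _].
  by move=> /negPf ->; rewrite mulr1 addr0.
by rewrite mulr0 add0r.
Qed.

Local Notation class w := (\pi_(GDN_quot S) (gdn_word w) : GDN_quot S).

Lemma Irr_spans (x : GDN_quot S) : exists r (c : word X -> k),
  (forall w, w \in r -> Irr S w) /\ x = \sum_(w <- r) c w *: class w.
Proof.
rewrite -[x]reprK; move: (repr x) => h.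
have [f [fI _ fs _]] := normal_form (valP h) (@upto_lead _ _ _ (gdn_val h)).
exists (msupp f), (fun w => f@_w); split=> //.
rewrite -pi_lincomb; apply/pi_eq.
have [s Is es] := span_Id fs.
suff -> : h - \sum_(w <- msupp f) f@_w *: gdn_word w = s by [].
apply: val_inj; rewrite [RHS]es raddfB; congr (_ - _).
rewrite -[RHS]/f [f in RHS]malgE; apply: gdn_sum_val => w /fI; by case.
Qed.

(** A relation lifts to an element of Id(S) supported on Irr(S); were it nonzero, its leading word
    would be both irreducible and reducible. *)
Lemma ideal_lead_free : ideal_lead S ->
  forall r (c : word X -> k), uniq r -> (forall w, w \in r -> Irr S w) ->
  \sum_(w <- r) c w *: class w = 0 -> forall w, w \in r -> c w = 0.
Proof.
move=> il r c ur rI; rewrite -pi_lincomb => e0.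
have wr w : w \in r -> wt w = -1 by move/rI; case.
pose F : G := \sum_(w <- r) c w *: gdn_word w.
have IF : Id S F.
  by rewrite -[F]subr0; apply/pi_eq; rewrite e0; symmetry; exact: pi_zeror.
have cF w : (gdn_val F)@_w = if w \in r then c w else 0.
  by rewrite gdn_sum_val // mcoeff_lincomb.
have [F0|nz] := eqVneq (gdn_val F) 0.
  by move=> w w_r; move: (cF w); rewrite w_r F0 mcoeff0.
have [p tp] := ideal_lead_term il (Id_span IF) nz.
have lr : lead (gdn_val F) \in r.
  by move: (lead_in nz); rewrite -mcoeff_neq0 cF; case: ifP; rewrite ?eqxx.
by case: (Irr_no_term (rI _ lr) tp).
Qed.

(** If [lead h] were irreducible, the normal form of [h] would lie in Id(S) with a nonzero
    coefficient there, a linear dependence among classes of Irr(S). *)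
Lemma free_ideal_lead :
  (forall r (c : word X -> k), uniq r -> (forall w, w \in r -> Irr S w) ->
   \sum_(w <- r) c w *: class w = 0 -> forall w, w \in r -> c w = 0) ->
  ideal_lead S.
Proof.
move=> free; apply: term_ideal_lead => h sh h0.
have hh := span_homog sh.
case: (Irr_or_term (wt_lead h0 hh)) => // lI; exfalso.
have [f [fI _ fs /(_ lI) fl]] := normal_form hh (@upto_lead _ _ _ h).
have sf : span S xpredT f.
  (* Here f = h - (h - f), and both terms lie in the span. *)
  rewrite -[f](subKr h) -[X in X - _]addr0 -scaleN1r addrC.
  by apply: (spanZD _ fs); rewrite addr0.
have [F IF eF] := span_Id sf.
have lf : lead h \in msupp f by rewrite -mcoeff_neq0 fl; exact: LC_neq0.
suff e : \sum_(w <- msupp f) f@_w *: class w = 0.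
  have := free (msupp f) (fun w => f@_w) (fset_uniq _) fI e _ lf.
  by apply/eqP; rewrite fl; exact: LC_neq0.
rewrite -pi_lincomb; transitivity (\pi_(GDN_quot S) (0 : G)); last exact: pi_zeror.
apply/pi_eq; rewrite subr0.
suff -> : \sum_(w <- msupp f) f@_w *: gdn_word w = F by [].
apply: val_inj; rewrite [RHS]eF [RHS]malgE; apply: gdn_sum_val => w /fI.
by case.
Qed.

End NormalForms.

Theorem theorem2 (k : fieldType) (d : Order.disp_t) (X : orderType d)
    (S : set (GDN k X)) :
  [pchar k] =i pred0 ->
  well_founded (fun a b : X => (a < b)%O) ->
  S !=set0 ->
  (GS_basis S <-> ideal_lead S) /\
  (ideal_lead S <->
   linear_basis (Irr S)
     (fun w : word X => \pi_(GDN_quot S) (gdn_word w) : GDN_quot S)).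
Proof.
move=> _ wfX _; split.
  by split; [exact: GS_ideal_lead|exact: ideal_lead_GS].
split=> [il|[free _]]; last exact: free_ideal_lead.
(* Independence rests on the leading-word condition, spanning on reduction to normal form. *)
by split; [exact: ideal_lead_free|move=> x; exact: Irr_spans].
Qed.
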